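(* Consider a project with startup costs in its restless reformulation (as defined in the context). The project is $\hat{\mathcal{F}}$-indexable, and its marginal productivity index (MPI) is given, for $(a^-,i)\in\{0,1\}\times N$, by $$\nu^{*}_{(a^-,i)}=\nu^{\mathrm{AT}}_{(a^-,i)}\triangleq\max_{\tau>0}\frac{\mathsf{E}_i^{\tau}\Big[-(1-a^-)c_i+\sum_{t=0}^{\tau-1}R_{X(t)}\beta^t\Big]}{\mathsf{E}_i^{\tau}\Big[\sum_{t=0}^{\tau-1}\beta^t\Big]}=\max_{S\subseteq N\colon i\in S}\frac{f_i^S-(1-a^-)c_i}{g_i^S},$$ where $\tau$ ranges over stopping times (with $\tau\geq 1$) for the Markov chain $X(t)$ with transition matrix $\mathbf{P}$ started at $X(0)=i$.
   Context: Project: finite state space $N$, stochastic matrix $\mathbf{P}=(p_{ij})_{i,j\in N}$, active rewards $R_i\in\mathbb{R}$, startup costs $c_i\ge 0$ ($i\in N$), zero shutdown costs, discount factor $0<\beta<1$. Restless reformulation: the discounted Markov decision process with state space $\hat N=\{0,1\}\times N$ (states $(a^-,i)$, where $a^-$ is the previous action) and actions $a\in\{0,1\}$ in every state. In state $(a^-,i)$, action $1$ (''engage'') yields reward $R_i-(1-a^-)c_i$ and moves the state to $(1,j)$ with probability $p_{ij}$; action $0$ (''rest'') yields reward $0$ and moves the state to $(0,i)$ with probability $1$. For a nonanticipative policy $\pi$ and initial state $(a^-,i)$, $f^{\pi}_{(a^-,i)}$ is the expected total $\beta$-discounted reward and $g^{\pi}_{(a^-,i)}=\mathsf{E}^{\pi}_{(a^-,i)}[\sum_{t\ge0}a(t)\beta^t]$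 is the expected total discounted work. For $\nu\in\mathbb{R}$, the $\nu$-wage problem is $\max_\pi f^{\pi}_{(a^-,i)}-\nu g^{\pi}_{(a^-,i)}$. For $S_0,S_1\subseteq N$ write $S_0\oplus S_1=(\{0\}\times S_0)\cup(\{1\}\times S_1)$. For each $\nu$, the minimal optimal active set $S_0^*(\nu)\oplus S_1^*(\nu)\subseteq\hat N$ is the set of all states of $\hat N$ in which engaging is the only optimal action for the $\nu$-wage problem. The project is indexable if there is an index $\nu^*_{(a^-,i)}\in\mathbb{R}$, $(a^-,i)\in\hat N$, with $$S_0^*(\nu)=\{i\in N:\nu^*_{(0,i)}>\nu\},\qquad S_1^*(\nu)=\{i\in N:\nu^*_{(1,i)}>\nu\},\qquad \nu\in\mathbb{R};$$ this index is then called the MPI. Let $\hat{\mathcal F}=\{S_0\oplus S_1: S_0\subseteq S_1\subseteq N\}$. The project is $\hat{\mathcal F}$-indexable if it is indexable and $S_0^*(\nu)\oplus S_1^*(\nu)\in\hat{\mathcal F}$ for all $\nu\in\mathbb{R}$. Underlying project without switching costs: state space $N$; when engaged in state $i$ it yields $R_i$ and moves to $j$ with probability $p_{ij}$; when rested it yields $0$ and its state is unchanged. For $S\subseteq N$, $f_i^S$ and $g_i^S$ are the expected total discounted reward and expected total discounted work starting at $i$ under the policy that engages the project exactly when its state lies in $S$. *)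

(* Defs.v *)
From HB Require Import structures.
From mathcomp Require Import all_boot all_order all_algebra.
From mathcomp Require Import all_classical all_reals all_analysis.
Set Implicit Arguments.
Unset Strict Implicit.
Unset Printing Implicit Defensive.
Import Order.TTheory GRing.Theory Num.Theory.
Import numFieldNormedType.Exports.
Local Open Scope ring_scope.

Section Process.
Variables (R : realType) (T : finType).

(* A process with values in T is given by the conditional law [K h] of its next
   value after the past [h] (oldest value first).  [expect K z n F] is the
   expectation of a functional [F] of the trajectory that depends only on its
   values at times 0, ..., n - 1; the finite path is completed into a
   trajectory with the irrelevant default value [z]. *)
Definition expect (K : seq T -> T -> R) (z : T) (n : nat)
    (F : (nat -> T) -> R) : R :=
  \sum_(w : n.-tuple T) (\prod_(t < n) K (take t w) (tnth w t)) * F (nth z w).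

(* Expectation of an infinite-horizon total whose truncation to the times
   0, ..., n - 1 is [F n]. *)
Definition expect_total (K : seq T -> T -> R) (z : T)
    (F : nat -> (nat -> T) -> R) : R :=
  limn (fun n => expect K z n (F n)).

End Process.

Section DecisionProcess.
Variables (R : realType) (X : finType).

(* Actions are booleans: [true] is "engage", [false] is "rest". *)
Record mdp := MDP {
  reward : X -> bool -> R;
  trans : X -> bool -> X -> R }.

(* Nonanticipative (history-dependent, randomized) policies: [pi h x] is the
   probability of engaging in state [x] after the past state-action pairs
   [h]. *)
Definition is_policy (pi : seq (X * bool) -> X -> R) : Prop :=
  forall h x, 0 <= pi h x <= 1.

Definition mdp_kernel (M : mdp) (pi : seq (X * bool) -> X -> R) (x0 : X)
    (h : seq (X * bool)) (z : X * bool) : R :=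
  (if h is u :: h' then trans M (last u h').1 (last u h').2 z.1
   else (z.1 == x0)%:R)
  * (if z.2 then pi h z.1 else 1 - pi h z.1).

Definition discounted_reward (beta : R) (M : mdp)
    (pi : seq (X * bool) -> X -> R) (x0 : X) : R :=
  expect_total (mdp_kernel M pi x0) (x0, false)
    (fun n w => \sum_(t < n) reward M (w t).1 (w t).2 * beta ^+ t).

Definition discounted_work (beta : R) (M : mdp)
    (pi : seq (X * bool) -> X -> R) (x0 : X) : R :=
  expect_total (mdp_kernel M pi x0) (x0, false)
    (fun n w => \sum_(t < n) (w t).2%:R * beta ^+ t).

Definition wage_value (beta : R) (M : mdp) (nu : R)
    (pi : seq (X * bool) -> X -> R) (x0 : X) : R :=
  discounted_reward beta M pi x0 - nu * discounted_work beta M pi x0.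

Definition wage_optimal (beta : R) (M : mdp) (nu : R)
    (pi : seq (X * bool) -> X -> R) (x0 : X) : Prop :=
  is_policy pi /\
  forall pi', is_policy pi' ->
    wage_value beta M nu pi' x0 <= wage_value beta M nu pi x0.

(* Action [a] is optimal in state [x] when some policy that takes it first
   is optimal from [x]. *)
Definition optimal_action (beta : R) (M : mdp) (nu : R) (x : X) (a : bool)
    : Prop :=
  exists pi, wage_optimal beta M nu pi x /\ pi [::] x = a%:R.

Definition min_optimal_active (beta : R) (M : mdp) (nu : R) : {set X} :=
  [set x | `[< optimal_action beta M nu x true /\
               ~ optimal_action beta M nu x false >]]%SET.

Definition active_policy (S : {set X}) (h : seq (X * bool)) (x : X) : R :=
  (x \in S)%:R.

End DecisionProcess.

Section Project.
Variables (R : realType) (N : finType).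

Definition stochastic (P : N -> N -> R) : Prop :=
  (forall i j, 0 <= P i j) /\ (forall i, \sum_j P i j = 1).

Definition project_mdp (P : N -> N -> R) (r : N -> R) : mdp R N :=
  MDP (fun i a => if a then r i else 0)
      (fun i a j => if a then P i j else (j == i)%:R).

Definition startup_mdp (P : N -> N -> R) (r c : N -> R) : mdp R (bool * N)%type :=
  @MDP R (bool * N)%type
    (fun s a => if a then r s.2 - (1 - s.1%:R) * c s.2 else 0)
    (fun s a s' => if a then s'.1%:R * P s.2 s'.2
                   else (s' == (false, s.2))%:R).

Definition oplus (S0 S1 : {set N}) : {set (bool * N)%type} :=
  [set s | if s.1 then s.2 \in S1 else s.2 \in S0]%SET.

Definition Fhat : {set {set (bool * N)%type}} :=
  [set A | [exists S0 : {set N}, exists S1 : {set N},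
             (S0 \subset S1) && (A == oplus S0 S1)]]%SET.

(* [opt_part P r c beta a nu] is S_a^*(nu). *)
Definition opt_part (P : N -> N -> R) (r c : N -> R) (beta : R) (a : bool)
    (nu : R) : {set N} :=
  [set i | (a, i) \in min_optimal_active beta (startup_mdp P r c) nu]%SET.

Definition is_MPI (P : N -> N -> R) (r c : N -> R) (beta : R)
    (idx : bool * N -> R) : Prop :=
  forall nu a, opt_part P r c beta a nu = [set i | nu < idx (a, i)]%SET.

Definition indexable (P : N -> N -> R) (r c : N -> R) (beta : R) : Prop :=
  exists idx, is_MPI P r c beta idx.

Definition Fhat_indexable (P : N -> N -> R) (r c : N -> R) (beta : R) : Prop :=
  indexable P r c beta /\
  forall nu, oplus (opt_part P r c beta false nu) (opt_part P r c beta true nu)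
               \in Fhat.

Definition active_reward (P : N -> N -> R) (r : N -> R) (beta : R)
    (S : {set N}) (i : N) : R :=
  discounted_reward beta (project_mdp P r) (active_policy R S) i.

Definition active_work (P : N -> N -> R) (r : N -> R) (beta : R)
    (S : {set N}) (i : N) : R :=
  discounted_work beta (project_mdp P r) (active_policy R S) i.

Definition chain_kernel (P : N -> N -> R) (i : N) (h : seq N) (j : N) : R :=
  if h is k :: h' then P (last k h') j else (j == i)%:R.

(* Stopping times of the natural filtration of the coordinate process on
   trajectories; [None] is the value +oo.  As N is finite, {tau = t} belongs to
   the sigma-algebra of X(0), ..., X(t) iff it is determined by these values. *)
Definition is_stopping_time (tau : (nat -> N) -> option nat) : Prop :=
  forall t w w', (forall k, (k <= t)%N -> w k = w' k) ->
    tau w = Some t -> tau w' = Some t.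

Definition before (t : nat) (s : option nat) : bool :=
  if s is Some n then (t < n)%N else true.

Definition stopped_reward (P : N -> N -> R) (r c : N -> R) (beta : R)
    (a : bool) (i : N) (tau : (nat -> N) -> option nat) : R :=
  expect_total (chain_kernel P i) i
    (fun n w => - (1 - a%:R) * c i
                + \sum_(t < n | before t (tau w)) r (w t) * beta ^+ t).

Definition stopped_work (P : N -> N -> R) (beta : R) (i : N)
    (tau : (nat -> N) -> option nat) : R :=
  expect_total (chain_kernel P i) i
    (fun n w => \sum_(t < n | before t (tau w)) beta ^+ t).

End Project.

Definition is_maximum (R : realType) (A : set R) (m : R) : Prop :=
  A m /\ ubound A m.

(* Main.v *)
Require Import Defs.
From HB Require Import structures.
From mathcomp Require Import all_boot all_order all_algebra.
From mathcomp Require Import all_classical all_reals all_analysis.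
From mathcomp Require Import ring.
Set Implicit Arguments.
Unset Strict Implicit.
Unset Printing Implicit Defensive.
Import Order.TTheory GRing.Theory Num.Theory.
Import numFieldNormedType.Exports.
Local Open Scope ring_scope.

(** Fix a wage [nu].  The optimal stopping problem for the chain has a value
    function [u = max 0 q], [q i = r i - nu + beta * \sum_j P i j * u j]: the
    number [q i] is the best value of [r - nu] accumulated until a stopping time
    [tau >= 1] from [i], and equally the best value of a set [S] containing [i];
    any set between [q > 0] and [q >= 0] attains it.  The function
    [max 0 (q i - (1 - a) * c i)] solves the Bellman equation of the startup-cost
    process, so [(a, i)] is in the minimal optimal active set iff
    [(1 - a) * c i < q i], that is, iff [nu] is below some ratio
    [(f^S - (1 - a) * c i) / g^S] with [i \in S].  Hence the index is the largest
    such ratio.  With [nu] equal to it, [q i = (1 - a) * c i], and a stopping time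
    that is optimal for [q i] has that same ratio. *)

(** * Discounted totals of a process given by its conditional laws *)

Section PathValue.
Variables (R : realType) (T : finType).
Implicit Types (K : seq T -> T -> R) (rho u : seq T -> R) (n : nat).

Definition stochastic_kernel K : Prop :=
  (forall h x, 0 <= K h x) /\ (forall h, \sum_x K h x = 1).

Lemma kernel_cons K x :
  stochastic_kernel K -> stochastic_kernel (fun h => K (x :: h)).
Proof. by move=> [K0 K1]; split. Qed.

(** The functional reads the finite path itself instead of a completed trajectory, so no default
    value enters and conditioning on the first value gives a recursion. *)
Definition path_expect K n (Phi : seq T -> R) : R :=
  \sum_(w : n.-tuple T) (\prod_(t < n) K (take t w) (tnth w t)) * Phi w.

Lemma path_expect0 K (Phi : seq T -> R) : path_expect K 0 Phi = Phi [::].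
Proof.
rewrite /path_expect (big_pred1 [tuple]) ?big_ord0 ?mul1r // => w.
by rewrite [w]tuple0 /= eqxx.
Qed.

Lemma path_expectS K n (Phi : seq T -> R) :
  path_expect K n.+1 Phi =
  \sum_x K [::] x *
    path_expect (fun h => K (x :: h)) n (fun w => Phi (x :: w)).
Proof.
rewrite /path_expect.
under [RHS]eq_bigr do rewrite mulr_sumr.
rewrite pair_bigA /=.
rewrite (reindex (fun p : T * n.-tuple T => cons_tuple p.1 p.2)) /=; last first.
  exists (fun w : n.+1.-tuple T => (thead w, behead_tuple w)) => [[x w] _|w _] /=.
    by congr pair; apply/val_inj.
  by apply/val_inj; rewrite /= [in RHS](tuple_eta w).
apply: eq_bigr => -[x w] _ /=.
rewrite big_ord_recl /= mulrA; congr (_ * _ * _).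
by apply: eq_bigr => t _; rewrite tnthS.
Qed.

Lemma path_expect_cst K n a : stochastic_kernel K -> path_expect K n (fun=> a) = a.
Proof.
elim: n K => [|n IH] K Kk; first by rewrite path_expect0.
rewrite path_expectS -[RHS]mul1r -(Kk.2 [::]) mulr_suml.
by apply: eq_bigr => x _; rewrite IH //; exact: kernel_cons.
Qed.

Lemma path_expect_affine K n a b (Phi : seq T -> R) : stochastic_kernel K ->
  path_expect K n (fun w => a + b * Phi w) = a + b * path_expect K n Phi.
Proof.
move=> Kk; rewrite -[in RHS](path_expect_cst n a Kk) /path_expect mulr_sumr -big_split.
by apply: eq_bigr => w _; rewrite /= mulrDr mulrCA.
Qed.

Variable beta : R.

(** [rho h] is the reward paid when the path has just become [h]. Conditioning on the first value
    shifts both kernel and reward by it, so dependence on the whole past stays within the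
    recursion. *)
Fixpoint path_value n K rho : R :=
  if n is n'.+1 then
    \sum_x K [::] x * (rho [:: x] +
      beta * path_value n' (fun h => K (x :: h)) (fun h => rho (x :: h)))
  else 0.

Lemma path_expectE K rho n : stochastic_kernel K ->
  path_expect K n (fun w => \sum_(t < n) beta ^+ t * rho (take t.+1 w)) =
  path_value n K rho.
Proof.
elim: n K rho => [|n IH] K rho Kk; first by rewrite path_expect0 big_ord0.
rewrite path_expectS /=; apply: eq_bigr => x _; congr (_ * _).
have Kx := kernel_cons x Kk.
rewrite -(IH _ _ Kx) -(path_expect_affine _ _ _ _ Kx).
apply: eq_bigr => w _; congr (_ * _).
rewrite big_ord_recl take0 expr0 mul1r; congr (_ + _).
by rewrite mulr_sumr; apply: eq_bigr => t _; rewrite exprS mulrA.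
Qed.

(** [u] is a supersolution: it majorizes what can still be collected after each past. Unfolding its
    inequality [n] times leaves a terminal term, which is at least [- beta ^+ n * B]. *)
Lemma path_value_le n K rho u B : stochastic_kernel K -> 0 <= beta ->
  (forall h, \sum_x K h x * (rho (rcons h x) + beta * u (rcons h x)) <= u h) ->
  (forall h, - B <= u h) ->
  path_value n K rho <= u [::] + beta ^+ n * B.
Proof.
move=> Kk b0; elim: n K rho u Kk => [|n IH] K rho u Kk us uB /=.
  by rewrite expr0 mul1r -lerBlDr sub0r.
rewrite -lerBlDr; apply: le_trans (us [::]).
rewrite -[beta ^+ n.+1 * B]mul1r -(Kk.2 [::]) mulr_suml -sumrB.
apply: ler_sum => x _; rewrite -mulrBr; apply: ler_wpM2l; first exact: Kk.1.
rewrite -addrA lerD2l lerBlDr exprS -mulrA -mulrDr ler_wpM2l //.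
by apply: (IH _ _ (fun h => u (x :: h)) (kernel_cons x Kk)) => h; first exact: us.
Qed.

Lemma path_value_lin n K rho rho' a :
  path_value n K (fun h => rho h + a * rho' h) =
  path_value n K rho + a * path_value n K rho'.
Proof.
elim: n K rho rho' => [|n IH] K rho rho' /=; first by rewrite mulr0 addr0.
rewrite mulr_sumr -big_split; apply: eq_bigr => x _ /=; rewrite IH; ring.
Qed.

Lemma path_valueN n K rho :
  path_value n K (fun h => - rho h) = - path_value n K rho.
Proof.
elim: n K rho => [|n IH] K rho /=; first by rewrite oppr0.
rewrite -sumrN; apply: eq_bigr => x _; rewrite IH; ring.
Qed.

Lemma path_value_ndecr n K rho : stochastic_kernel K -> 0 <= beta -> (forall h, 0 <= rho h) ->
  path_value n K rho <= path_value n.+1 K rho.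
Proof.
move=> Kk b0; elim: n K rho Kk => [|n IH] K rho Kk rho0.
  by apply: sumr_ge0 => x _; rewrite /= mulr0 addr0 mulr_ge0 ?Kk.1.
apply: ler_sum => x _; rewrite ler_wpM2l ?Kk.1 // lerD2l ler_wpM2l //.
by apply: IH => //; exact: kernel_cons.
Qed.

Hypotheses (beta_ge0 : 0 <= beta) (beta_lt1 : beta < 1).

Definition bounded_by C rho := forall h, `|rho h| <= C.

Lemma path_value_ub n K rho C : stochastic_kernel K -> bounded_by C rho ->
  path_value n K rho <= C / (1 - beta).
Proof.
move=> Kk Cb; have C0 : 0 <= C by apply: le_trans (Cb [::]).
have b1 : 0 < 1 - beta by rewrite subr_gt0.
(* The constant [C / (1 - beta)] solves [x = C + beta * x], so it is a supersolution; it is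
   nonnegative, so the tail bound can be taken with [B = 0]. *)
rewrite -[leRHS]addr0 -(mulr0 (beta ^+ n)).
apply: (@path_value_le _ _ _ (fun=> C / (1 - beta))) => // h; last first.
  by rewrite oppr0 divr_ge0 // ltW.
rewrite [leRHS](_ : _ = \sum_x K h x * (C + beta * (C / (1 - beta)))); last first.
  rewrite -mulr_suml Kk.2 mul1r; field; exact: lt0r_neq0.
apply: ler_sum => x _; rewrite ler_wpM2l ?Kk.1 // lerD2r.
exact: le_trans (ler_norm _) (Cb _).
Qed.

Lemma is_cvg_path_value K rho C : stochastic_kernel K -> bounded_by C rho ->
  cvgn (fun n => path_value n K rho).
Proof.
move=> Kk Cb; have C0 : 0 <= C by apply: le_trans (Cb [::]).
(* A bounded reward is the difference of the nonnegative rewards [rho + C] and [C], whose partial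
   totals are monotone and bounded. *)
suff H rho' : (forall h, 0 <= rho' h) -> bounded_by (C + C) rho' ->
    cvgn (fun n => path_value n K rho').
  have -> : (fun n => path_value n K rho) =
      (fun n => path_value n K (fun h => rho h + C) - path_value n K (fun=> C)).
    apply/funext => n; rewrite -[X in _ - X]mul1r -mulNr -path_value_lin.
    by congr path_value; apply/funext => h; rewrite mulN1r addrK.
  apply: is_cvgB; apply: H => // h.
  - by rewrite addrC -lerBlDl sub0r lerNnormlW.
  - by apply: le_trans (ler_normD _ _) _; rewrite (ger0_norm C0) lerD2r.
  - by rewrite ger0_norm // lerDl.
move=> rho0 rhob; apply: nondecreasing_is_cvgn.
  by apply/nondecreasing_seqP => n; apply: path_value_ndecr.
by exists ((C + C) / (1 - beta)) => _ [n _ <-]; apply: path_value_ub.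
Qed.

Definition total_value K rho := limn (fun n => path_value n K rho).

Lemma total_value_lin K rho rho' a C C' : stochastic_kernel K ->
  bounded_by C rho -> bounded_by C' rho' ->
  total_value K (fun h => rho h + a * rho' h) =
  total_value K rho + a * total_value K rho'.
Proof.
move=> Kk Cb Cb'; rewrite /total_value.
under eq_fun do rewrite path_value_lin.
have c1 := is_cvg_path_value Kk Cb; have c2 := is_cvg_path_value Kk Cb'.
by apply: cvg_lim => //; apply: cvgD => //; apply: cvgMr.
Qed.

Lemma total_valueN K rho C : stochastic_kernel K -> bounded_by C rho ->
  total_value K (fun h => - rho h) = - total_value K rho.
Proof.
move=> Kk Cb; rewrite /total_value; under eq_fun do rewrite path_valueN.
by apply: cvg_lim => //; apply: cvgN; exact: is_cvg_path_value Cb.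
Qed.

(** The tail term of the finite-horizon bound vanishes in the limit because [beta < 1]. *)
Lemma total_value_le K rho u B C : stochastic_kernel K -> bounded_by C rho ->
  bounded_by B u ->
  (forall h, \sum_x K h x * (rho (rcons h x) + beta * u (rcons h x)) <= u h) ->
  total_value K rho <= u [::].
Proof.
move=> Kk Cb Bb us.
have c : ((fun n => u [::] + beta ^+ n * B) @ \oo --> u [::])%classic.
  rewrite -[X in (_ --> X)%classic]addr0 -(mul0r B).
  apply: cvgD; first exact: cvg_cst.
  by apply: cvgMl; apply: cvg_expr; rewrite ger0_norm.
rewrite -[leRHS](cvg_lim _ c) //; apply: ler_lim.
- exact: is_cvg_path_value Cb.
- by apply/cvg_ex; exists (u [::]).
- apply: nearW => n; apply: path_value_le => // h.
  by have := Bb h; rewrite ler_norml => /andP[].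
Qed.

Lemma total_value_ge K rho u B C : stochastic_kernel K -> bounded_by C rho ->
  bounded_by B u ->
  (forall h, u h <= \sum_x K h x * (rho (rcons h x) + beta * u (rcons h x))) ->
  u [::] <= total_value K rho.
Proof.
move=> Kk Cb Bb us; rewrite -lerN2 -(total_valueN Kk Cb).
apply: (@total_value_le _ _ (fun h => - u h) B C) => // [h|h|h].
- by rewrite normrN.
- by rewrite normrN.
rewrite -[leRHS]opprK opprK lerNr -sumrN; apply: le_trans (us h) _.
by apply: ler_sum => x _; rewrite -mulrN opprD opprK mulrN opprK.
Qed.

(** This links [expect_total] to the recursion for functionals that accumulate rewards read off
    prefixes; [a] is a lump sum paid at the start, such as the startup cost. *)
Lemma expect_totalE K z rho F a C : stochastic_kernel K -> bounded_by C rho ->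
  (forall n w, size w = n ->
     F n (nth z w) = a + \sum_(t < n) beta ^+ t * rho (take t.+1 w)) ->
  expect_total K z F = a + total_value K rho.
Proof.
move=> Kk Cb FE; rewrite /expect_total.
have -> : (fun n => expect K z n (F n)) = (fun n => a + path_value n K rho).
  apply/funext => n; rewrite -path_expectE //.
  rewrite -[X in _ + X]mul1r -path_expect_affine //.
  by apply: eq_bigr => w _; rewrite FE ?size_tuple // mul1r.
apply: cvg_lim => //; apply: cvgD; first exact: cvg_cst.
exact: is_cvg_path_value Cb.
Qed.

End PathValue.

Lemma finite_bound (R : realType) (I : finType) (f : I -> R) :
  exists C, forall i, `|f i| <= C.
Proof.
exists (\sum_i `|f i|) => i; rewrite (bigD1 i) //= lerDl.
by apply: sumr_ge0 => j _.
Qed.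

(** * Controlled processes and verification by the Bellman equation *)

Section ControlledProcess.
Variables (R : realType) (X : finType) (M : mdp R X) (beta : R).
Hypotheses (trans_ge0 : forall x a y, 0 <= trans M x a y)
  (trans_sum : forall x a, \sum_y trans M x a y = 1)
  (beta_ge0 : 0 <= beta) (beta_lt1 : beta < 1).
Implicit Types (pi : seq (X * bool) -> X -> R) (rho : X -> bool -> R) (V : X -> R).

Lemma sum_mdp_kernel pi x0 h (F : X -> bool -> R) :
  \sum_z mdp_kernel M pi x0 h z * F z.1 z.2 =
  \sum_y (if h is u :: h' then trans M (last u h').1 (last u h').2 y
          else (y == x0)%:R)
    * (pi h y * F y true + (1 - pi h y) * F y false).
Proof.
rewrite -(pair_bigA _ (fun y a => mdp_kernel M pi x0 h (y, a) * F y a)) /=.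
apply: eq_bigr => y _; rewrite big_bool /mdp_kernel /= -!mulrA -mulrDr.
by [].
Qed.

Lemma sum_eq_mul x0 (F : X -> R) : \sum_y (y == x0)%:R * F y = F x0.
Proof.
rewrite (bigD1 x0) //= eqxx mul1r big1 ?addr0 // => y /negPf ->.
by rewrite mul0r.
Qed.

Lemma mdp_kernelP pi x0 : is_policy pi -> stochastic_kernel (mdp_kernel M pi x0).
Proof.
move=> pip; split=> [h z|h].
  have /andP[p0 p1] := pip h z.1; apply: mulr_ge0; first by case: h {p0 p1}.
  by case: z.2; rewrite ?subr_ge0.
under eq_bigr do rewrite -[mdp_kernel _ _ _ _ _]mulr1.
rewrite (sum_mdp_kernel pi x0 h (fun _ _ => 1)).
under eq_bigr do rewrite !mulr1 addrC subrK mulr1.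
case: h => [|u h]; last exact: trans_sum.
by rewrite -[RHS](sum_eq_mul x0 (fun=> 1)); under [RHS]eq_bigr do rewrite mulr1.
Qed.

Definition policy_total pi x0 rho : R :=
  expect_total (mdp_kernel M pi x0) (x0, false)
    (fun n w => \sum_(t < n) rho (w t).1 (w t).2 * beta ^+ t).

(** The default pair is seen only at the empty history, where the recursion pays no reward. *)
Definition last_reward (x0 : X) rho (h : seq (X * bool)) : R :=
  rho (last (x0, false) h).1 (last (x0, false) h).2.

Lemma last_reward_bounded x0 rho : exists C, bounded_by C (last_reward x0 rho).
Proof.
have [C CP] := finite_bound (fun z : X * bool => rho z.1 z.2).
by exists C => h; exact: CP.
Qed.

Lemma policy_totalE pi x0 rho : is_policy pi ->
  policy_total pi x0 rho =
  total_value beta (mdp_kernel M pi x0) (last_reward x0 rho).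
Proof.
move=> pip; have [C Cb] := last_reward_bounded x0 rho.
rewrite -[RHS]add0r.
apply: (expect_totalE beta_ge0 beta_lt1 (mdp_kernelP x0 pip) Cb) => n w wn.
rewrite add0r; apply: eq_bigr => t _.
rewrite /last_reward (take_nth (x0, false)) ?wn // last_rcons.
by rewrite mulrC.
Qed.

Lemma policy_total_lin pi x0 rho rho' a : is_policy pi ->
  policy_total pi x0 (fun x b => rho x b + a * rho' x b) =
  policy_total pi x0 rho + a * policy_total pi x0 rho'.
Proof.
move=> pip; rewrite !policy_totalE //.
have [C Cb] := last_reward_bounded x0 rho.
have [C' Cb'] := last_reward_bounded x0 rho'.
by apply: (total_value_lin beta_ge0 beta_lt1 a _ Cb Cb'); exact: mdp_kernelP.
Qed.

Definition action_value rho V x a := rho x a + beta * \sum_y trans M x a y * V y.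

Definition mixed_value pi rho V (h : seq (X * bool)) x :=
  pi h x * action_value rho V x true + (1 - pi h x) * action_value rho V x false.

(* Value of continuing after the history [h] when [V] is collected from the
   next state on; before the first action it is the value of the initial
   decision. *)
Definition continuation pi x0 rho V (h : seq (X * bool)) : R :=
  if h is u :: h' then \sum_y trans M (last u h').1 (last u h').2 y * V y
  else mixed_value pi rho V [::] x0.

Lemma continuation_bounded pi x0 rho V :
  exists B, bounded_by B (continuation pi x0 rho V).
Proof.
have [B BP] := finite_bound (fun z : X * bool => \sum_y trans M z.1 z.2 y * V y).
exists (`|mixed_value pi rho V [::] x0| + B) => -[|u h] /=.
  by rewrite lerDl (le_trans _ (BP (x0, true))).
by apply: le_trans (BP (last u h)) _; rewrite lerDr.
Qed.

Lemma continuation_step pi x0 rho V h :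
  \sum_z mdp_kernel M pi x0 h z *
     (last_reward x0 rho (rcons h z) + beta * continuation pi x0 rho V (rcons h z)) =
  \sum_y (if h is u :: h' then trans M (last u h').1 (last u h').2 y
          else (y == x0)%:R) * mixed_value pi rho V h y.
Proof.
rewrite -(sum_mdp_kernel pi x0 h (action_value rho V)); apply: eq_bigr => z _.
rewrite /last_reward last_rcons /action_value; congr (_ * (_ + _ * _)).
by case: h => //= u h; rewrite last_rcons.
Qed.

(** [continuation] is a supersolution on histories. The hypothesis leaves out the empty history so
    that the first decision stays arbitrary: it is evaluated exactly, and only later decisions are
    compared with [V]. *)
Lemma policy_total_le pi x0 rho V : is_policy pi ->
  (forall h y, h != [::] -> mixed_value pi rho V h y <= V y) ->
  policy_total pi x0 rho <= mixed_value pi rho V [::] x0.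
Proof.
move=> pip H; rewrite policy_totalE //.
have [C Cb] := last_reward_bounded x0 rho.
have [B Bb] := continuation_bounded pi x0 rho V.
apply: (total_value_le beta_ge0 beta_lt1 (mdp_kernelP x0 pip) Cb Bb) => h.
rewrite continuation_step; case: h => [|u h]; first by rewrite sum_eq_mul.
by apply: ler_sum => y _; rewrite ler_wpM2l // H.
Qed.

Lemma policy_total_ge pi x0 rho V : is_policy pi ->
  (forall h y, h != [::] -> V y <= mixed_value pi rho V h y) ->
  mixed_value pi rho V [::] x0 <= policy_total pi x0 rho.
Proof.
move=> pip H; rewrite policy_totalE //.
have [C Cb] := last_reward_bounded x0 rho.
have [B Bb] := continuation_bounded pi x0 rho V.
apply: (total_value_ge beta_ge0 beta_lt1 (mdp_kernelP x0 pip) Cb Bb) => h.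
rewrite continuation_step; case: h => [|u h]; first by rewrite sum_eq_mul.
by apply: ler_sum => y _; rewrite ler_wpM2l // H.
Qed.

Definition wage_reward (nu : R) x (a : bool) := reward M x a - nu * a%:R.

Lemma wage_valueE nu pi x0 : is_policy pi ->
  wage_value beta M nu pi x0 = policy_total pi x0 (wage_reward nu).
Proof.
move=> pip; rewrite -[LHS]/(policy_total pi x0 (reward M) - nu *
  policy_total pi x0 (fun _ a => a%:R)) -mulNr -policy_total_lin //.
by congr policy_total; apply/funext => x; apply/funext => a; rewrite mulNr.
Qed.

(** A policy that starts with [a] earns at most the action value of [a], and acting greedily for [V]
    afterwards earns at least that much. So the best policy starting with [a] is optimal iff this
    action value reaches the maximum [V x]. *)
Lemma optimal_actionP nu V x a :
  (forall y, V y = Num.max (action_value (wage_reward nu) V y true)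
                           (action_value (wage_reward nu) V y false)) ->
  optimal_action beta M nu x a <-> action_value (wage_reward nu) V x a = V x.
Proof.
set Q := action_value (wage_reward nu) V => VE.
have QV y b : Q y b <= V y by rewrite VE; case: b; rewrite le_max lexx ?orbT.
have mixed_le pi h y : is_policy pi ->
    mixed_value pi (wage_reward nu) V h y <= V y.
  move=> pip; have /andP[p0 p1] := pip h y.
  rewrite -[V y]mul1r -[X in X * V y](subrKC (pi h y)) mulrDl.
  by rewrite lerD // ler_wpM2l ?subr_ge0 //; exact: QV.
(* The first action is forced to be [b]; afterwards the better action for [V] is taken, resting in
   case of a tie. *)
pose greedy (b : bool) (h : seq (X * bool)) y : R :=
  if h is [::] then b%:R else (Q y false < Q y true)%R%:R.
have greedyP b : is_policy (greedy b).
  by move=> [|u h] y /=; [case: b|case: ltP]; rewrite lexx ler01.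
have mixed_greedy b y : mixed_value (greedy b) (wage_reward nu) V [::] y = Q y b.
  by rewrite /mixed_value; case: b; rewrite /= ?subrr ?subr0 mul0r mul1r ?addr0 ?add0r.
have value_greedy b y : Q y b <= wage_value beta M nu (greedy b) y.
  rewrite wage_valueE // -mixed_greedy; apply: policy_total_ge => // -[|u h] // z _.
  rewrite /mixed_value /= VE -/(Q z true) -/(Q z false).
  by case: ltP => ?; rewrite ?subrr ?subr0 mul0r mul1r ?addr0 ?add0r.
have value_le pi y : is_policy pi -> wage_value beta M nu pi y <=
    mixed_value pi (wage_reward nu) V [::] y.
  move=> pip; rewrite wage_valueE //; apply: policy_total_le => // h z _.
  exact: mixed_le.
split=> [[pi [[pip popt] pix]]|Qx].
  apply/le_anti; rewrite QV /=.
  have vQ : wage_value beta M nu pi x <= Q x a.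
    rewrite -(mixed_greedy a); apply: le_trans (value_le _ _ pip) _.
    by rewrite /mixed_value pix.
  apply: le_trans vQ.
  rewrite VE ge_max; apply/andP; split;
    exact: le_trans (value_greedy _ _) (popt _ (greedyP _)).
exists (greedy a); split=> //; split=> // pi' pip'.
apply: le_trans (value_le _ _ pip') _; apply: le_trans (mixed_le _ _ _ pip') _.
by rewrite -Qx.
Qed.

End ControlledProcess.

(** * Optimal stopping of the Markov chain *)

Section Chain.
Variables (R : realType) (N : finType) (P : N -> N -> R) (beta : R).
Hypotheses (P_stochastic : stochastic P) (beta_ge0 : 0 <= beta) (beta_lt1 : beta < 1).
Implicit Types (g u : N -> R) (i j : N) (tau : (nat -> N) -> option nat).

Let P_ge0 i j : 0 <= P i j. Proof. exact: P_stochastic.1. Qed.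

Definition continue_value g u i := g i + beta * \sum_j P i j * u j.

(** Value iteration from 0 is nondecreasing and bounded by [C / (1 - beta)]; its limit is a fixed
    point by continuity. *)
Lemma stopping_fixpoint g :
  exists u, forall i, u i = Num.max 0 (continue_value g u i).
Proof.
have [C Cb] := finite_bound g.
pose v := fix v k i := if k is k'.+1 then Num.max 0 (continue_value g (v k') i) else 0.
have continue_le u u' i : (forall j, u j <= u' j) ->
    continue_value g u i <= continue_value g u' i.
  move=> uu'; rewrite lerD2l ler_wpM2l //; apply: ler_sum => j _.
  by rewrite ler_wpM2l.
have v_ndecr k i : v k i <= v k.+1 i.
  elim: k i => [|k IH] i; first by rewrite /= le_max lexx.
  by rewrite [v k.+1 i]/= [v k.+2 i]/= le_max2 // continue_le.
have v_ub k i : v k i <= C / (1 - beta).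
  have b1 : 0 < 1 - beta by rewrite subr_gt0.
  have C0 : 0 <= C by apply: le_trans (Cb i).
  elim: k i => [|k IH] i /=; first by rewrite divr_ge0 // ltW.
  rewrite ge_max divr_ge0 //=; last exact: ltW.
  apply: le_trans (continue_le _ (fun=> C / (1 - beta)) _ IH) _.
  rewrite /continue_value -mulr_suml P_stochastic.2 mul1r.
  apply: (@le_trans _ _ (C + beta * (C / (1 - beta)))).
    by rewrite lerD2r; apply: le_trans (ler_norm _) (Cb i).
  by rewrite le_eqVlt; apply/orP; left; apply/eqP; field; exact: lt0r_neq0.
have v_cvg i : cvgn (v ^~ i).
  apply: nondecreasing_is_cvgn; first by apply/nondecreasing_seqP => n.
  by exists (C / (1 - beta)) => _ [n _ <-].
exists (fun i => limn (v ^~ i)) => i.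
apply: cvg_lim => //; rewrite -cvg_shiftS.
have -> : [sequence v n.+1 i]_n = (fun n => Num.max 0 (continue_value g (v n) i)) by [].
(* Written with an absolute value, the maximum passes to the limit through sums, products and
   norms. *)
rewrite maxr_absE; under eq_fun do rewrite maxr_absE.
have cc : ((fun n => continue_value g (v n) i) @ \oo -->
    continue_value g (fun j => limn (v ^~ j)) i)%classic.
  apply: cvgD; first exact: cvg_cst.
  apply: cvgMr; apply: cvg_big => [|j _]; first exact: add_continuous.
  by apply: cvgMr; exact: v_cvg.
apply: cvgMl; apply: cvgD; first by apply: cvgD; [exact: cvg_cst|].
by apply: cvg_norm; apply: cvgB; [exact: cvg_cst|].
Qed.

Lemma chain_kernelP i : stochastic_kernel (chain_kernel P i).
Proof.
split=> [[|k h] j //=|[|k h]]; rewrite /= ?P_stochastic.2 //.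
by rewrite -[RHS](sum_eq_mul i (fun=> 1)); under [RHS]eq_bigr do rewrite mulr1.
Qed.

(** If one trajectory has stopped at some [m <= t], agreement up to [m] makes the other stop at [m]
    too. *)
Lemma before_prefix tau t w w' : is_stopping_time tau ->
  (forall k, (k <= t)%N -> w k = w' k) ->
  before t (tau w) = before t (tau w').
Proof.
move=> st; suff H v v' : (forall k, (k <= t)%N -> v k = v' k) ->
    before t (tau v) -> before t (tau v').
  by move=> ww'; apply/idP/idP; apply: H => // k kt; rewrite ww'.
move=> vv'; apply: contraTT; case E: (tau v') => [m|] //=; rewrite -leqNgt => mt.
rewrite (st m v' v) //= -?leqNgt // => k km.
by rewrite vv' // (leq_trans km).
Qed.

(** The last entry of [h] is the value at time [(size h).-1]. The path is completed by the constant
    [i], which is harmless because for a stopping time [before] depends only on the values up to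
    that time. *)
Definition stopped_payoff i tau g (h : seq N) : R :=
  (before (size h).-1 (tau (nth i h)))%:R * g (last i h).

Lemma stopped_payoff_bounded i tau g : exists C, bounded_by C (stopped_payoff i tau g).
Proof.
have [C Cb] := finite_bound g; exists C => h; rewrite /stopped_payoff normrM.
case: before; first by rewrite normr1 mul1r.
by rewrite normr0 mul0r; apply: le_trans (Cb i).
Qed.

Definition stopped_value i tau g :=
  total_value beta (chain_kernel P i) (stopped_payoff i tau g).

Lemma stopped_valueE a i tau g : is_stopping_time tau ->
  expect_total (chain_kernel P i) i
    (fun n w => a + \sum_(t < n | before t (tau w)) g (w t) * beta ^+ t) =
  a + stopped_value i tau g.
Proof.
move=> st; have [C Cb] := stopped_payoff_bounded i tau g.
apply: (expect_totalE beta_ge0 beta_lt1 (chain_kernelP i) Cb) => n w wn.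
congr (_ + _); rewrite big_mkcond; apply: eq_bigr => t _.
have tw : (t < size w)%N by rewrite wn.
rewrite /stopped_payoff size_takel //= (take_nth i) // last_rcons.
rewrite (before_prefix (w' := nth i (rcons (take t w) (nth i w t))) st) => [|k kt].
  by case: before; rewrite ?mul0r ?mulr0 // mul1r mulrC.
by rewrite -take_nth // nth_take // ltnS.
Qed.

Lemma stopped_rewardE r c a i tau : is_stopping_time tau ->
  stopped_reward P r c beta a i tau = - (1 - a%:R) * c i + stopped_value i tau r.
Proof. exact: stopped_valueE. Qed.

Lemma stopped_workE i tau : is_stopping_time tau ->
  stopped_work P beta i tau = stopped_value i tau (fun=> 1).
Proof.
move=> st; rewrite -[RHS]add0r -stopped_valueE //; congr expect_total.
apply/funext => n; apply/funext => w; rewrite add0r.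
by apply: eq_bigr => t _; rewrite mul1r.
Qed.

(** Work being positive, comparing a ratio with [nu] amounts to finding the sign of this net value,
    which is an optimal stopping payoff for the reward [r - nu]. *)
Lemma stopped_net nu r c a i tau : is_stopping_time tau ->
  stopped_reward P r c beta a i tau - nu * stopped_work P beta i tau =
  - (1 - a%:R) * c i + stopped_value i tau (fun j => r j - nu).
Proof.
move=> st; rewrite stopped_rewardE // stopped_workE // -addrA; congr (_ + _).
have [C Cb] := stopped_payoff_bounded i tau r.
have [C' Cb'] := stopped_payoff_bounded i tau (fun=> 1).
rewrite -mulNr -(total_value_lin beta_ge0 beta_lt1 _ (chain_kernelP i) Cb Cb').
by congr total_value; apply/funext => h; rewrite /stopped_payoff; ring.
Qed.

(* The value after the history [h] of continuing until [tau], when [u] is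
   collected from the next state on. *)
Definition stopped_continuation i tau g u (h : seq N) : R :=
  if h is k :: h' then
    (before (size h') (tau (nth i h)))%:R * \sum_j P (last k h') j * u j
  else continue_value g u i.

Lemma stopped_continuation_bounded i tau g u :
  exists B, bounded_by B (stopped_continuation i tau g u).
Proof.
have [B Bb] := finite_bound (fun k => \sum_j P k j * u j).
exists (`|continue_value g u i| + B) => -[|k h] /=.
  by rewrite lerDl (le_trans _ (Bb i)).
rewrite normrM; apply: (@le_trans _ _ B); last by rewrite lerDr.
case: before; first by rewrite normr1 mul1r.
by rewrite normr0 mul0r; apply: le_trans (Bb i).
Qed.

Lemma stopped_continuation_step i tau g u h j :
  stopped_payoff i tau g (rcons h j) +
    beta * stopped_continuation i tau g u (rcons h j) =
  (before (size h) (tau (nth i (rcons h j))))%:R * continue_value g u j.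
Proof.
rewrite /stopped_payoff size_rcons last_rcons /continue_value.
by case: h => [|k h] /=; rewrite ?size_rcons ?last_rcons; ring.
Qed.

Lemma sum_chain_kernel0 i (F : N -> R) :
  \sum_j chain_kernel P i [::] j * F j = F i.
Proof. exact: sum_eq_mul. Qed.

(** [stopped_continuation] is a supersolution: at each later state, [u] dominates both stopping,
    worth 0, and continuing. The condition at time 0 forces the first reward to be taken, hence the
    bound by the continuation value rather than by [u i]. *)
Lemma stopped_value_le i tau g u : is_stopping_time tau ->
  (forall w, before 0 (tau w)) ->
  (forall j, u j = Num.max 0 (continue_value g u j)) ->
  stopped_value i tau g <= continue_value g u i.
Proof.
move=> st tau0 uE.
have [C Cb] := stopped_payoff_bounded i tau g.
have [B Bb] := stopped_continuation_bounded i tau g u.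
apply: (total_value_le beta_ge0 beta_lt1 (chain_kernelP i) Cb Bb) => h.
under eq_bigr do rewrite stopped_continuation_step.
case: h => [|k h]; first by rewrite sum_chain_kernel0 tau0 mul1r.
rewrite [leRHS]/=; case: (boolP (before _ (tau (nth i (k :: h))))) => [_|nb].
  rewrite mul1r; apply: ler_sum => j _; rewrite ler_wpM2l ?P_ge0 // uE.
  by case: before; rewrite ?mul1r ?mul0r le_max lexx ?orbT.
(* A stopped path stays stopped when extended, so nothing more is collected. *)
rewrite mul0r big1 // => j _.
suff -> : before (size (k :: h)) (tau (nth i (rcons (k :: h) j))) = false.
  by rewrite mul0r mulr0.
apply: contraNF nb => b.
have : before (size h) (tau (nth i (rcons (k :: h) j))).
  by move: b; case: (tau _) => //= m; exact: ltnW.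
rewrite (before_prefix (w' := nth i (k :: h)) st) // => l lh.
by rewrite nth_rcons /= ltnS lh.
Qed.

(** The unit of work at time 0 is always done; the zero function is a lower bound for all later
    work. *)
Lemma stopped_work_ge1 i tau : is_stopping_time tau ->
  (forall w, before 0 (tau w)) -> 1 <= stopped_work P beta i tau.
Proof.
move=> st tau0; rewrite stopped_workE //.
have [C Cb] := stopped_payoff_bounded i tau (fun=> 1).
have [B Bb] := stopped_continuation_bounded i tau (fun=> 1) (fun=> 0).
have cont1 j : continue_value (fun=> 1) (fun=> 0) j = 1 :> R.
  by rewrite /continue_value big1 ?mulr0 ?addr0 // => k _; rewrite mulr0.
rewrite -[leLHS](cont1 i).
apply: (total_value_ge beta_ge0 beta_lt1 (chain_kernelP i) Cb Bb) => h.
under eq_bigr do rewrite stopped_continuation_step cont1 mulr1.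
case: h => [|k h]; first by rewrite sum_chain_kernel0 tau0 [leLHS]cont1.
rewrite /= big1 => [|j _]; last exact: mulr0.
by rewrite mulr0; apply: sumr_ge0 => j _; rewrite mulr_ge0.
Qed.

(** Time 0 is not tested, so the exit time is at least 1 even when the chain starts outside [S]. *)
Definition exit_time (S : {set N}) (w : nat -> N) : option nat :=
  match pselect (exists n, (0 < n)%N && (w n \notin S)) with
  | left ex => Some (ex_minn ex)
  | right _ => None
  end.

Lemma exit_timeP S w t : exit_time S w = Some t <->
  [/\ (0 < t)%N, w t \notin S & forall k, (0 < k < t)%N -> w k \in S].
Proof.
rewrite /exit_time; case: pselect => [ex|nex]; last first.
  by split=> // -[t0 wt _]; case: nex; exists t; rewrite t0.
case: ex_minnP => m /andP[m0 wm] mmin; split=> [[<-]|[t0 wt tmin]].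
  split=> // k /andP[k0 km]; apply: contraTT km => wk.
  by rewrite -leqNgt mmin // k0.
congr Some; apply/eqP; rewrite eqn_leq mmin ?t0 //= leqNgt; apply/negP => mt.
by move: wm; rewrite tmin // m0.
Qed.

Lemma exit_time_stopping S : is_stopping_time (exit_time S).
Proof.
move=> t w w' ww' /exit_timeP[t0 wt tmin]; apply/exit_timeP; split=> //.
  by rewrite -ww'.
by move=> k kt; rewrite -ww' ?tmin //; case/andP: kt => _ /ltnW.
Qed.

Lemma exit_time_gt0 S w : before 0 (exit_time S w).
Proof. by case E: (exit_time S w) => [t|] //=; case/exit_timeP: E. Qed.

Lemma before_exit_timeS S w t :
  before t.+1 (exit_time S w) = before t (exit_time S w) && (w t.+1 \in S).
Proof.
case E: (exit_time S w) => [m|] /=.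
  have [m0 wm mmin] := (exit_timeP S w m).1 E.
  rewrite ltn_neqAle andbC; case: (ltnP t m) => //= tm.
  move: tm; rewrite leq_eqVlt => /predU1P[->|tm]; first by rewrite eqxx (negPf wm).
  by rewrite mmin // (ltn_eqF tm).
apply/esym/negPn/negP => wt.
have : exists n, (0 < n)%N && (w n \notin S) by exists t.+1.
by move: E; rewrite /exit_time; case: pselect.
Qed.

(** In [S] continuing is worth [u], and outside [S] both stopping and [u] are worth 0, so the exit
    rule makes an optimal choice at every positive time. *)
Lemma exit_value_ge i g u (S : {set N}) :
  (forall j, u j = Num.max 0 (continue_value g u j)) ->
  (forall j, j \in S -> 0 <= continue_value g u j) ->
  (forall j, j \notin S -> continue_value g u j <= 0) ->
  continue_value g u i <= stopped_value i (exit_time S) g.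
Proof.
move=> uE Spos Sneg; have st := @exit_time_stopping S.
have [C Cb] := stopped_payoff_bounded i (exit_time S) g.
have [B Bb] := stopped_continuation_bounded i (exit_time S) g u.
apply: (total_value_ge beta_ge0 beta_lt1 (chain_kernelP i) Cb Bb) => h.
under eq_bigr do rewrite stopped_continuation_step.
case: h => [|k h]; first by rewrite sum_chain_kernel0 exit_time_gt0 mul1r.
rewrite [leLHS]/= mulr_sumr; apply: ler_sum => j _.
rewrite mulrCA ler_wpM2l ?P_ge0 // [size (k :: h)]/= before_exit_timeS.
rewrite (before_prefix (t := size h) (w' := nth i (k :: h)) st) => [|l lh]; last first.
  by rewrite nth_rcons /= ltnS lh.
rewrite nth_rcons ltnn eqxx; case: before; rewrite ?mul0r // !mul1r uE /=.
by case: (boolP (j \in S)) => [/Spos/max_idPr ->|/Sneg/max_idPl ->]; rewrite ?mul1r ?mul0r.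
Qed.

End Chain.

(** * The project, its startup-cost version and the index *)

Section Index.
Variables (R : realType) (N : finType) (P : N -> N -> R) (r c : N -> R) (beta : R).
Hypotheses (P_stochastic : stochastic P) (c_ge0 : forall i, 0 <= c i)
  (beta_gt0 : 0 < beta) (beta_lt1 : beta < 1).

Let beta_ge0 : 0 <= beta. Proof. exact: ltW. Qed.
Local Notation pM := (project_mdp P r).
Local Notation sM := (startup_mdp P r c).

Lemma project_trans_ge0 i a j : 0 <= trans pM i a j.
Proof. by case: a => //=; exact: P_stochastic.1. Qed.

Lemma project_trans_sum i a : \sum_j trans pM i a j = 1.
Proof.
case: a => /=; first exact: P_stochastic.2.
by rewrite -[RHS](sum_eq_mul i (fun=> 1)); under [RHS]eq_bigr do rewrite mulr1.
Qed.

Lemma sum_startup_trans s a (V : bool * N -> R) :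
  \sum_y trans sM s a y * V y =
  if a then \sum_j P s.2 j * V (true, j) else V (false, s.2).
Proof.
case: a => /=; last exact: sum_eq_mul.
transitivity (\sum_(b : bool) \sum_j b%:R * P s.2 j * V (b, j)).
  by rewrite pair_bigA; apply: eq_bigr => -[b j].
rewrite big_bool /= [X in _ + X]big1 ?addr0 => [|j _]; last by rewrite !mul0r.
by apply: eq_bigr => j _; rewrite mul1r.
Qed.

Lemma startup_trans_ge0 s a y : 0 <= trans sM s a y.
Proof. by case: a => //=; rewrite mulr_ge0 // P_stochastic.1. Qed.

Lemma startup_trans_sum s a : \sum_y trans sM s a y = 1.
Proof.
under eq_bigr do rewrite -[trans _ _ _ _]mulr1.
rewrite (sum_startup_trans s a (fun=> 1)); case: a => //.
by under eq_bigr do rewrite mulr1; exact: P_stochastic.2.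
Qed.

Lemma active_policyP (S : {set N}) : is_policy (active_policy R S).
Proof. by move=> h i; rewrite /active_policy; case: in_mem; rewrite lexx ler01. Qed.

Lemma active_work_ge1 (S : {set N}) i : i \in S -> 1 <= active_work P r beta S i.
Proof.
move=> iS; pose g (_ : N) (a : bool) : R := a%:R.
have g0 a y : action_value pM beta g (fun=> 0) y a = a%:R.
  by rewrite /action_value big1 ?mulr0 ?addr0 // => j _; rewrite mulr0.
have mE h y : mixed_value pM beta (active_policy R S) g (fun=> 0) h y = (y \in S)%:R.
  by rewrite /mixed_value !g0 mulr1 mulr0 addr0.
have := @policy_total_ge R N pM beta project_trans_ge0 project_trans_sum beta_ge0
  beta_lt1 (active_policy R S) i g (fun=> 0) (active_policyP S).
rewrite mE iS; apply=> h y _; by rewrite mE.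
Qed.

(** * Both decision processes at a fixed wage *)

Section Wage.
Variables (nu : R) (u : N -> R).
Let q := continue_value P beta (fun j => r j - nu) u.
Hypothesis uE : forall i, u i = Num.max 0 (q i).

Let u_ge0 i : 0 <= u i. Proof. by rewrite uE le_max lexx. Qed.
Let q_le i : q i <= u i. Proof. by rewrite uE le_max lexx orbT. Qed.

Lemma project_action_value i a :
  action_value pM beta (wage_reward pM nu) u i a = if a then q i else beta * u i.
Proof.
case: a; rewrite /action_value /wage_reward /= ?mulr1 //.
by rewrite mulr0 subrr add0r sum_eq_mul.
Qed.

Lemma project_mixed_value (S : {set N}) h i :
  mixed_value pM beta (active_policy R S) (wage_reward pM nu) u h i =
  if i \in S then q i else beta * u i.
Proof.
rewrite /mixed_value !project_action_value /active_policy.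
by case: in_mem; rewrite ?subrr ?subr0 mul1r mul0r ?addr0 ?add0r.
Qed.

Lemma active_net (S : {set N}) i :
  active_reward P r beta S i - nu * active_work P r beta S i =
  policy_total pM beta (active_policy R S) i (wage_reward pM nu).
Proof.
exact (wage_valueE project_trans_ge0 project_trans_sum beta_ge0 beta_lt1 nu i
  (active_policyP S)).
Qed.

(** Resting freezes the project, so it is worth [beta * u], at most [u] since [u] is nonnegative.
    Hence [u] is a supersolution for every active set, and [i \in S] makes the first decision worth
    [q i]. *)
Lemma active_net_le (S : {set N}) i : i \in S ->
  active_reward P r beta S i - nu * active_work P r beta S i <= q i.
Proof.
move=> iS; rewrite active_net.
have <- : mixed_value pM beta (active_policy R S) (wage_reward pM nu) u [::] i = q i.
  by rewrite project_mixed_value iS.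
apply: policy_total_le => //.
- exact: project_trans_ge0.
- exact: project_trans_sum.
- exact: active_policyP.
move=> h y _; rewrite project_mixed_value; case: ifP => // _.
by rewrite ler_piMl // ltW.
Qed.

Lemma active_net_ge (S : {set N}) i : i \in S ->
  (forall j, j \in S -> 0 <= q j) -> (forall j, j \notin S -> q j <= 0) ->
  q i <= active_reward P r beta S i - nu * active_work P r beta S i.
Proof.
move=> iS Spos Sneg; rewrite active_net.
have <- : mixed_value pM beta (active_policy R S) (wage_reward pM nu) u [::] i = q i.
  by rewrite project_mixed_value iS.
apply: policy_total_ge => //.
- exact: project_trans_ge0.
- exact: project_trans_sum.
- exact: active_policyP.
move=> h y _; rewrite project_mixed_value uE.
case: (boolP (y \in S)) => [/Spos/max_idPr -> //|/Sneg/max_idPl ->].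
by rewrite mulr0.
Qed.

(* Resting in [(a, i)] leads to [(false, i)], whose value is at most that of
   [(a, i)]; by discounting, resting is optimal only where the value is 0. *)
Lemma min_optimal_activeE (a : bool) i :
  ((a, i) \in min_optimal_active beta sM nu) = ((1 - a%:R) * c i < q i).
Proof.
pose d (s : bool * N) := (1 - s.1%:R) * c s.2.
pose V s := Num.max 0 (q s.2 - d s).
have d_false j : d (false, j) = c j by rewrite /d subr0 mul1r.
have d_true j : d (true, j) = 0 by rewrite /d subrr mul0r.
have d_le s : d s <= d (false, s.2).
  by case: s => -[] j; rewrite ?d_true d_false.
have QT s : action_value sM beta (wage_reward sM nu) V s true = q s.2 - d s.
  (* Engaging leads to states [(true, j)], where no startup cost is due and [V] equals [u j]. *)
  rewrite /action_value sum_startup_trans /wage_reward /= mulr1.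
  under eq_bigr => j _ do rewrite /V d_true subr0 -uE.
  by rewrite /q /continue_value /d; ring.
have QF s : action_value sM beta (wage_reward sM nu) V s false = beta * V (false, s.2).
  by rewrite /action_value sum_startup_trans /wage_reward /= mulr0 subr0 add0r.
have V_ge0 s : 0 <= V s by rewrite le_max lexx.
have V_le s : V (false, s.2) <= V s.
  by rewrite /V le_max2 // lerD2l lerN2.
have VE s : V s = Num.max (action_value sM beta (wage_reward sM nu) V s true)
                          (action_value sM beta (wage_reward sM nu) V s false).
  rewrite QT QF; have rest_le : beta * V (false, s.2) <= V s.
    by apply: le_trans (V_le s); rewrite ler_piMl // ltW.
  have act_le : q s.2 - d s <= V s by rewrite /V le_max lexx orbT.
  apply/le_anti/andP; split.
    by rewrite {1}/V ge_max !le_max (mulr_ge0 beta_ge0 (V_ge0 _)) lexx orbT.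
  by rewrite ge_max act_le rest_le.
have oP s a' := @optimal_actionP R _ sM beta startup_trans_ge0 startup_trans_sum
  beta_ge0 beta_lt1 nu V s a' VE.
rewrite inE; apply/asboolP/idP => [[_ nrest]|lt].
  rewrite ltNge; apply/negP => ge; apply: nrest; apply/oP.
  have V0 : V (a, i) = 0 by apply/max_idPl; rewrite subr_le0.
  rewrite QF V0; suff -> : V (false, i) = 0 by rewrite mulr0.
  by apply/le_anti; rewrite V_ge0 -V0 (V_le (a, i)).
have Vp : V (a, i) = q i - d (a, i) by apply/max_idPr; rewrite subr_ge0 ltW.
have Vpos : 0 < V (a, i) by rewrite Vp subr_gt0.
split; first by apply/oP; rewrite QT Vp.
move/oP; rewrite QF => E; suff : V (a, i) < V (a, i) by rewrite ltxx.
rewrite -{1}E; apply: le_lt_trans (_ : beta * V (a, i) < _).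
  by rewrite ler_wpM2l // (V_le (a, i)).
by rewrite gtr_pMl.
Qed.

End Wage.

(** * The index as the largest ratio over active sets *)

Definition active_ratio (a : bool) i (S : {set N}) : R :=
  (active_reward P r beta S i - (1 - a%:R) * c i) / active_work P r beta S i.

(** The maximum is over finitely many sets; the singleton shows that the range is nonempty. *)
Definition AT_index (s : bool * N) : R :=
  active_ratio s.1 s.2
    [arg max_(S > ([set s.2])%SET | s.2 \in S) active_ratio s.1 s.2 S]%O.

Lemma AT_index_max a i :
  (exists2 S : {set N}, i \in S & active_ratio a i S = AT_index (a, i)) /\
  (forall S : {set N}, i \in S -> active_ratio a i S <= AT_index (a, i)).
Proof.
rewrite /AT_index /=; case: Order.TotalTheory.arg_maxP => [|S iS Smax].
  by rewrite inE.
by split=> [|S' iS']; [exists S|exact: Smax].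
Qed.

Lemma active_ratio_gt nu (a : bool) i (S : {set N}) : i \in S ->
  (nu < active_ratio a i S) =
  ((1 - a%:R) * c i < active_reward P r beta S i - nu * active_work P r beta S i).
Proof.
move=> iS; rewrite ltr_pdivlMr; last exact: lt_le_trans (active_work_ge1 iS).
by rewrite ltrBrDl ltrBrDl addrC.
Qed.

Lemma startup_cost_ge0 (a : bool) i : 0 <= (1 - a%:R) * c i.
Proof. by case: a; rewrite ?subrr ?mul0r // subr0 mul1r. Qed.

(** A ratio above [nu] means a net value above the startup cost, and net values over sets containing
    [i] are bounded by [q i]. Conversely the set [q > 0] attains [q i]; it contains [i] because the
    startup cost is nonnegative. *)
Lemma AT_index_gt nu u (a : bool) i :
  (forall j, u j = Num.max 0 (continue_value P beta (fun j => r j - nu) u j)) ->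
  (nu < AT_index (a, i)) =
  ((1 - a%:R) * c i < continue_value P beta (fun j => r j - nu) u i).
Proof.
set q := continue_value _ _ _ _ => uE.
have [[S iS SE] Smax] := AT_index_max a i.
apply/idP/idP => [|lt].
  rewrite -SE active_ratio_gt // => /lt_le_trans; apply.
  exact: active_net_le uE _ _ iS.
have qi : 0 < q i by exact: le_lt_trans (startup_cost_ge0 a i) lt.
have iS' : i \in [set j | 0 < q j]%SET by rewrite inE.
apply: lt_le_trans (Smax _ iS'); rewrite active_ratio_gt //.
apply: lt_le_trans lt _; apply: (active_net_ge uE iS') => j; rewrite inE.
  exact: ltW.
by rewrite -leNgt.
Qed.

Lemma opt_partE a nu : opt_part P r c beta a nu = [set i | nu < AT_index (a, i)]%SET.
Proof.
have [u uE] := stopping_fixpoint P_stochastic beta_ge0 beta_lt1 (fun j => r j - nu).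
apply/setP => i; rewrite /opt_part finset.in_set (min_optimal_activeE uE).
by rewrite -(AT_index_gt _ _ uE) finset.in_set.
Qed.

(** The index is not above itself, which bounds [q i] from above; at this wage the maximizing set
    has net value exactly equal to the startup cost, which bounds it from below. *)
Lemma AT_index_continue u (a : bool) i (nu := AT_index (a, i)) :
  (forall j, u j = Num.max 0 (continue_value P beta (fun j => r j - nu) u j)) ->
  continue_value P beta (fun j => r j - nu) u i = (1 - a%:R) * c i.
Proof.
move=> uE; apply/le_anti; rewrite leNgt -(AT_index_gt _ _ uE) ltxx /=.
have [[S iS SE] _] := AT_index_max a i.
apply: le_trans (active_net_le uE iS).
have w0 : active_work P r beta S i != 0.
  by rewrite gt_eqF // (lt_le_trans _ (active_work_ge1 iS)).
by rewrite /nu -SE /active_ratio divfK // opprB addrCA subrr addr0.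
Qed.

Lemma AT_index_stopping (a : bool) i :
  is_maximum
    [set stopped_reward P r c beta a i tau / stopped_work P beta i tau
    | tau in [set tau : (nat -> N) -> option nat
             | is_stopping_time tau /\ forall w, before 0 (tau w)]]%classic
    (AT_index (a, i)).
Proof.
set nu := AT_index (a, i).
have [u uE] := stopping_fixpoint P_stochastic beta_ge0 beta_lt1 (fun j => r j - nu).
have qi := AT_index_continue uE.
have ub tau : is_stopping_time tau -> (forall w, before 0 (tau w)) ->
    stopped_reward P r c beta a i tau / stopped_work P beta i tau <= nu.
  move=> st tau0.
  rewrite ler_pdivrMr; last first.
    exact: lt_le_trans (stopped_work_ge1 P_stochastic beta_ge0 beta_lt1 i st tau0).
  rewrite -subr_le0 (stopped_net P_stochastic beta_ge0 beta_lt1) //.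
  rewrite mulNr addrC subr_le0 -qi; exact: stopped_value_le.
split=> [|_ [tau [st tau0] <-]]; last exact: ub.
(* The set must lie between [q > 0] and [q >= 0]; [i] may belong to it because at this wage [q i] is
   the startup cost, which is nonnegative. *)
pose S := (i |: [set j | 0 < continue_value P beta (fun j => r j - nu) u j])%SET.
have st := @exit_time_stopping N S; have tau0 := @exit_time_gt0 N S.
exists (exit_time S) => //; apply/le_anti; rewrite ub //=.
rewrite ler_pdivlMr; last first.
  exact: lt_le_trans (stopped_work_ge1 P_stochastic beta_ge0 beta_lt1 i st tau0).
rewrite -subr_ge0 (stopped_net P_stochastic beta_ge0 beta_lt1) //.
rewrite mulNr addrC subr_ge0 -qi.
apply: exit_value_ge => // j; rewrite !inE.
  by case/predU1P => [->|/ltW //]; rewrite qi startup_cost_ge0.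
by rewrite negb_or -leNgt => /andP[].
Qed.

End Index.

Theorem theorem3p7 (R : realType) (N : finType) (P : N -> N -> R)
    (r c : N -> R) (beta : R)
    (P_stochastic : stochastic P)
    (c_ge0 : forall i, 0 <= c i)
    (beta_gt0 : 0 < beta) (beta_lt1 : beta < 1) :
  Fhat_indexable P r c beta /\
  forall idx : bool * N -> R, is_MPI P r c beta idx ->
    forall (a : bool) (i : N),
      is_maximum
        [set stopped_reward P r c beta a i tau / stopped_work P beta i tau
        | tau in [set tau : (nat -> N) -> option nat
                 | is_stopping_time tau /\ forall w, before 0 (tau w)]]%classic
        (idx (a, i)) /\
      is_maximum
        [set (active_reward P r beta S i - (1 - a%:R) * c i)
               / active_work P r beta S i
        | S in [set S : {set N} | i \in S]]%classic
        (idx (a, i)).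
Proof.
have optE nu a := opt_partE r P_stochastic c_ge0 beta_gt0 beta_lt1 a nu.
split.
  split; first by exists (AT_index P r c beta) => nu a; exact: optE.
  move=> nu; rewrite inE; apply/existsP; exists (opt_part P r c beta false nu).
  apply/existsP; exists (opt_part P r c beta true nu); rewrite eqxx andbT.
  have [u uE] := stopping_fixpoint P_stochastic (ltW beta_gt0) beta_lt1 (fun j => r j - nu).
  (* Both parts compare the same [q i] with a startup cost, [c i] or 0, so the inclusion follows
     from [0 <= c i]. *)
  apply/fintype.subsetP => i; rewrite !optE !inE.
  rewrite !(AT_index_gt P_stochastic c_ge0 beta_gt0 beta_lt1 _ _ uE).
  by rewrite subr0 mul1r subrr mul0r; apply: le_lt_trans.
move=> idx idxP a i.
(* The MPI is unique: a real number is determined by the wages strictly below it. *)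
have -> : idx (a, i) = AT_index P r c beta (a, i).
  have E nu : (nu < idx (a, i)) = (nu < AT_index P r c beta (a, i)).
    by have := idxP nu a; rewrite optE => /setP/(_ i); rewrite !inE.
  by apply/le_anti; rewrite !leNgt -E ltxx E ltxx.
split; first exact: AT_index_stopping.
have [[S iS SE] Smax] := AT_index_max P r c beta a i.
by split=> [|_ [S' iS' <-]]; [exists S|exact: Smax].
Qed.
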